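(* Let $G$ be a finite group, $K$ a finite field, $\Theta\in\mathrm{Hom}(G,\mathrm{Aut}(K))$, and let $\alpha:G\times G\to K^*$ be a normalized $2$-cocycle of $G$ stabilized by $\Theta(G)$. Then the twisted skew group ring $R=K[G,\Theta,\alpha]$ is a Frobenius ring.
   Context: A normalized $2$-cocycle of $G$ is a map $\alpha:G\times G\to K^*$ with $\alpha(g,1)=\alpha(1,g)=1$ for all $g$ and $\alpha(g_1,g_2g_3)\alpha(g_2,g_3)=\alpha(g_1g_2,g_3)\alpha(g_1,g_2)$ for all $g_1,g_2,g_3\in G$. It is stabilized by $\Theta(G)$ if $\Theta(g)(\alpha(x,y))=\alpha(x,y)$ for all $g,x,y\in G$. The twisted skew group ring $K[G,\Theta,\alpha]$ is the left $K$-vector space with basis $\{\overline g\mid g\in G\}$ and multiplication $\sum_g a_g\overline g\cdot\sum_h b_h\overline h=\sum_{g,h}a_g(\Theta(g)b_h)\alpha(g,h)\overline{gh}$; it is an associative ring with identity $\overline1$. For a finite ring $A$, let $\widehat A=\mathrm{Hom}_{\mathbb Z}(A,\mathbb C^\times)$ be the character group of $(A,+)$, a right $A$-module via $(\chi\cdot a)(a')=\chi(aa')$ for $a,a'\in A$, $\chi\in\widehat A$. A finite ring $A$ is Frobenius if and only if $A$ and $\widehat A$ are isomorphic as right $A$-modules (this characterization may be used as the definition). *)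

(* Defs.v *)
From HB Require Import structures.
From mathcomp Require Import all_boot all_order all_fingroup all_algebra.
From mathcomp Require Import complex Rstruct.

Set Implicit Arguments.
Unset Strict Implicit.
Unset Printing Implicit Defensive.

Import GRing.Theory.
Local Open Scope ring_scope.

Section TwistingData.
Variables (G : finGroupType) (K : finFieldType).

(* Theta is a homomorphism from G to Aut(K), the group law of Aut(K) being
   composition of functions: (s t)(x) = s (t x).  Preservation of the identity
   follows because the maps are bijective. *)
Definition hom_to_Aut (Theta : G -> {rmorphism K -> K}) : Prop :=
  (forall g, bijective (Theta g)) /\
  (forall (g h : G) x, Theta (g * h)%g x = Theta g (Theta h x)).

(* {unit K} is the group K^*, written multiplicatively in group_scope. *)
Definition normalized_cocycle (alpha : G -> G -> {unit K}) : Prop :=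
  (forall g, alpha g 1%g = 1%g /\ alpha 1%g g = 1%g) /\
  (forall g1 g2 g3 : G,
     (alpha g1 (g2 * g3) * alpha g2 g3 = alpha (g1 * g2) g3 * alpha g1 g2)%g).

Definition stabilized_by (Theta : G -> {rmorphism K -> K})
    (alpha : G -> G -> {unit K}) : Prop :=
  forall g x y : G, Theta g (val (alpha x y)) = val (alpha x y).

End TwistingData.

(* The twisted skew group ring K[G, Theta, alpha].  An element is the family
   of its K-coordinates in the basis (bar g)_(g : G).  The alias keeps the
   twisted product apart from the pointwise one on {ffun G -> K}. *)
Definition twisted_skew_group_ring (G : finGroupType) (K : finFieldType)
    (Theta : G -> {rmorphism K -> K}) (alpha : G -> G -> {unit K})
    (_ : hom_to_Aut Theta) (_ : normalized_cocycle alpha)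
    (_ : stabilized_by Theta alpha) : Type :=
  {ffun G -> K}.

Section TwistedSkewGroupRing.
Variables (G : finGroupType) (K : finFieldType).
Variables (Theta : G -> {rmorphism K -> K}) (alpha : G -> G -> {unit K}).
Hypotheses (homTheta : hom_to_Aut Theta) (cocyc : normalized_cocycle alpha).
Hypothesis stab : stabilized_by Theta alpha.

Local Notation R := (twisted_skew_group_ring homTheta cocyc stab).

HB.instance Definition _ := Finite.copy R {ffun G -> K}.
HB.instance Definition _ := GRing.Zmodule.copy R {ffun G -> K}.
HB.instance Definition _ := GRing.Lmodule.copy R {ffun G -> K^o}.

Definition tsg_bar (g : G) : R := [ffun h => (h == g)%:R].

Definition tsg_one : R := tsg_bar 1%g.

Definition tsg_mul (a b : R) : R :=
  \sum_(g : G) \sum_(h : G)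
    (a g * Theta g (b h) * val (alpha g h)) *: tsg_bar (g * h)%g.

Lemma tsg_sumE (a : R) : a = \sum_(g : G) a g *: tsg_bar g.
Proof.
apply/ffunP => k; rewrite sum_ffunE (bigD1 k) //= big1 => [|g gk].
  by rewrite !ffunE eqxx addr0 /GRing.scale /= mulr1.
by rewrite !ffunE eq_sym (negPf gk) scaler0.
Qed.

Lemma tsg_mulDl : left_distributive tsg_mul +%R.
Proof.
move=> a b c; rewrite /tsg_mul -big_split /=; apply: eq_bigr => g _.
rewrite -big_split /=; apply: eq_bigr => h _.
by rewrite ffunE !mulrDl scalerDl.
Qed.

Lemma tsg_mulDr : right_distributive tsg_mul +%R.
Proof.
move=> a b c; rewrite /tsg_mul -big_split /=; apply: eq_bigr => g _.
rewrite -big_split /=; apply: eq_bigr => h _.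
by rewrite ffunE rmorphD mulrDr mulrDl scalerDl.
Qed.

Lemma tsg_mul0l b : tsg_mul 0 b = 0.
Proof. by apply: (addrI (tsg_mul 0 b)); rewrite -tsg_mulDl !addr0. Qed.

Lemma tsg_mul0r a : tsg_mul a 0 = 0.
Proof. by apply: (addrI (tsg_mul a 0)); rewrite -tsg_mulDr !addr0. Qed.

Lemma tsg_mul_suml I (r : seq I) (F : I -> R) b :
  tsg_mul (\sum_(i <- r) F i) b = \sum_(i <- r) tsg_mul (F i) b.
Proof. exact: (big_morph (tsg_mul^~ b) (fun x y => tsg_mulDl x y b) (tsg_mul0l b)). Qed.

Lemma tsg_mul_sumr I (r : seq I) (F : I -> R) a :
  tsg_mul a (\sum_(i <- r) F i) = \sum_(i <- r) tsg_mul a (F i).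
Proof. exact: (big_morph (tsg_mul a) (tsg_mulDr a) (tsg_mul0r a)). Qed.

Lemma tsg_mul_bar (x y : K) (g h : G) :
  tsg_mul (x *: tsg_bar g) (y *: tsg_bar h) =
  (x * Theta g y * val (alpha g h)) *: tsg_bar (g * h)%g.
Proof.
have E z k l : (z *: tsg_bar k : R) l = z * (l == k)%:R by rewrite !ffunE.
rewrite /tsg_mul (bigD1 g) //= (bigD1 h) //= !E !eqxx !mulr1.
rewrite !big1 ?addr0 // => [g' /negPf gg'|h' /negPf hh'].
  by rewrite big1 // => h' _; rewrite !E gg' mulr0 !mul0r scale0r.
by rewrite !E hh' mulr0 rmorph0 mulr0 mul0r scale0r.
Qed.

Lemma Theta1 x : Theta 1%g x = x.
Proof.
case: homTheta => bij hom; apply: (bij_inj (bij 1%g)).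
by rewrite -hom mulg1.
Qed.

Lemma tsg_mulA : associative tsg_mul.
Proof.
have [_ hom] := homTheta; have [_ coc] := cocyc.
move=> a b c.
rewrite (tsg_sumE a) (tsg_mul_suml _ _ b) (tsg_mul_suml _ _ c).
rewrite (tsg_mul_suml _ _ (tsg_mul b c)); apply: eq_bigr => g1 _.
set x := a g1 *: _; rewrite (tsg_sumE b) [in LHS](tsg_mul_suml _ _ c).
rewrite [in LHS](tsg_mul_sumr _ _ x) [in RHS](tsg_mul_sumr _ _ x).
rewrite [in RHS](tsg_mul_suml _ _ c); apply: eq_bigr => g2 _.
set y := b g2 *: _; rewrite (tsg_sumE c).
rewrite [in RHS](tsg_mul_sumr _ _ (tsg_mul x y)) (tsg_mul_sumr _ _ y).
rewrite (tsg_mul_sumr _ _ x); apply: eq_bigr => g3 _; rewrite {}/x {}/y.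
rewrite !tsg_mul_bar mulgA; congr (_ *: _).
rewrite !rmorphM /= stab hom.
have := congr1 val (coc g1 g2 g3); rewrite !FinRing.val_unitM => E.
rewrite -!mulrA; congr (_ * (_ * _)).
rewrite [RHS]mulrCA; congr (_ * _).
by rewrite mulrC E mulrC.
Qed.

Lemma tsg_mul1l : left_id tsg_one tsg_mul.
Proof.
have [norm _] := cocyc.
move=> a; rewrite {2}(tsg_sumE a) {1}(tsg_sumE a) tsg_mul_sumr.
apply: eq_bigr => g _; rewrite -[tsg_one]scale1r tsg_mul_bar.
by rewrite mul1g Theta1 (norm g).2 mul1r mulr1.
Qed.

Lemma tsg_mul1r : right_id tsg_one tsg_mul.
Proof.
have [norm _] := cocyc.
move=> a; rewrite {2}(tsg_sumE a) {1}(tsg_sumE a) tsg_mul_suml.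
apply: eq_bigr => g _; rewrite -[tsg_one]scale1r tsg_mul_bar.
by rewrite mulg1 rmorph1 (norm g).1 !mulr1.
Qed.

Lemma tsg_one_neq0 : tsg_one != 0.
Proof.
apply/eqP => /ffunP/(_ 1%g); rewrite !ffunE eqxx => /eqP.
by rewrite oner_eq0.
Qed.

HB.instance Definition _ := GRing.Zmodule_isNzRing.Build R
  tsg_mulA tsg_mul1l tsg_mul1r tsg_mulDl tsg_mulDr tsg_one_neq0.

End TwistedSkewGroupRing.

(* The field of complex numbers, over the real numbers of Stdlib. *)
Definition complexR : numClosedFieldType := complex Rdefinitions.R.

Section CharacterModule.
Variable A : finPzRingType.

Definition is_character (chi : {ffun A -> complexR}) : bool :=
  [forall x, chi x != 0] &&
  [forall x, forall y, chi (x + y) == chi x * chi y].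

(* Homomorphisms from (A, +) to the multiplicative group of nonzero complex
   numbers; their pointwise product is written additively. *)
Record character := Character {
  char_val :> {ffun A -> complexR};
  _ : is_character char_val }.

HB.instance Definition _ := [isSub for char_val].
HB.instance Definition _ := [Choice of character by <:].

Lemma is_characterP (chi : {ffun A -> complexR}) :
  reflect ((forall x, chi x != 0) /\
           (forall x y, chi (x + y) = chi x * chi y)) (is_character chi).
Proof.
apply: (iffP andP) => -[/forallP nz]; last first.
  by move=> hom; split=> //; apply/'forall_forallP => x y; apply/eqP.
by move=> /'forall_forallP hom; split=> // x y; apply/eqP.
Qed.

Lemma char_neq0 (chi : character) x : chi x != 0.
Proof. by case: chi => chi /= /is_characterP[]. Qed.

Lemma charD (chi : character) x y : chi (x + y) = chi x * chi y.
Proof. by case: chi => chi /= /is_characterP[]. Qed.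

Lemma char_eqP (chi psi : character) : (forall x, chi x = psi x) -> chi = psi.
Proof. by move=> E; apply/val_inj/ffunP. Qed.

Fact char_zero_subproof : is_character [ffun => 1].
Proof.
by apply/is_characterP; split=> *; rewrite !ffunE ?oner_neq0 ?mulr1.
Qed.
Definition char_zero := Character char_zero_subproof.

Fact char_opp_subproof (chi : character) : is_character [ffun x => (chi x)^-1].
Proof.
apply/is_characterP; split=> *; rewrite !ffunE ?invr_eq0 ?char_neq0 //.
by rewrite charD invfM.
Qed.
Definition char_opp chi := Character (char_opp_subproof chi).

Fact char_add_subproof (chi psi : character) :
  is_character [ffun x => chi x * psi x].
Proof.
apply/is_characterP; split=> *; rewrite !ffunE.
  by rewrite mulf_neq0 ?char_neq0.
by rewrite !charD mulrACA.
Qed.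
Definition char_add chi psi := Character (char_add_subproof chi psi).

Lemma char_addA : associative char_add.
Proof. by move=> a b c; apply: char_eqP => x; rewrite !ffunE mulrA. Qed.
Lemma char_addC : commutative char_add.
Proof. by move=> a b; apply: char_eqP => x; rewrite !ffunE mulrC. Qed.
Lemma char_add0 : left_id char_zero char_add.
Proof. by move=> a; apply: char_eqP => x; rewrite !ffunE mul1r. Qed.
Lemma char_addN : left_inverse char_zero char_opp char_add.
Proof. by move=> a; apply: char_eqP => x; rewrite !ffunE mulVf ?char_neq0. Qed.

HB.instance Definition _ := GRing.isZmodule.Build character
  char_addA char_addC char_add0 char_addN.

(* The right action (chi . a)(a') = chi (a a').  Right A-modules are left
   modules over the opposite ring A^c, so a *: chi stands for chi . a. *)
Fact char_act_subproof (a : A) (chi : character) :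
  is_character [ffun x => chi (a * x)].
Proof.
by apply/is_characterP; split=> *; rewrite !ffunE ?char_neq0 ?mulrDr ?charD.
Qed.
Definition char_act (a : A^c) (chi : character) : character :=
  Character (char_act_subproof a chi).

Lemma char_actA (a b : A^c) chi :
  char_act a (char_act b chi) = char_act (a * b) chi.
Proof. by apply: char_eqP => x; rewrite !ffunE mulrA. Qed.
Lemma char_act1 : left_id 1 char_act.
Proof. by move=> a; apply: char_eqP => x; rewrite !ffunE mul1r. Qed.
Lemma char_actDr : right_distributive char_act +%R.
Proof. by move=> a chi psi; apply: char_eqP => x; rewrite !ffunE. Qed.
Lemma char_actDl chi : {morph char_act^~ chi : a b / a + b}.
Proof.
by move=> a b; apply: char_eqP => x; rewrite !ffunE mulrDl charD.
Qed.

HB.instance Definition _ := GRing.Zmodule_isLmodule.Build A^c character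
  char_actA char_act1 char_actDr char_actDl.

End CharacterModule.

(* A finite ring A is Frobenius when A and its character module are isomorphic
   as right A-modules.  (A^c)^o is A as a right module over itself: there
   a *: b is the product b a of A. *)
Definition frobenius_ring (A : finPzRingType) : Prop :=
  exists f : {linear (A^c)^o -> character A}, bijective f.

(* Main.v *)
(** Let psi be a nontrivial additive character of K and put
    eps(r) = psi(r_1), where r_1 is the coefficient of bar 1 in r.  If the
    coefficient of bar g in a is nonzero, then, Theta g being bijective and
    alpha having invertible values, the coefficient of bar 1 in
    a * (c bar g^-1), and in (c bar g^-1) * a, takes every value of K as c
    varies.  Hence eps is trivial on no nonzero one-sided ideal, and
    a |-> eps . a is an isomorphism onto the character module: it is injective
    by nondegeneracy on one side, and surjective by nondegeneracy on the other
    side and orthogonality of characters. *)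
Require Import Defs.
From HB Require Import structures.
From mathcomp Require Import all_boot all_order all_fingroup all_algebra.
From mathcomp Require Import all_field.

Set Implicit Arguments.
Unset Strict Implicit.
Unset Printing Implicit Defensive.

Import GRing.Theory Num.Theory.
Local Open Scope ring_scope.

Section GeneratingCharacter.
Variables (A : finPzRingType) (eps : character A).

Lemma character0 (chi : character A) : chi 0 = 1.
Proof.
by apply: (mulfI (char_neq0 chi 0)); rewrite -charD addr0 mulr1.
Qed.

(** Translating the summation variable by [y] multiplies the sum by [phi y], so the sum is killed by
    [1 - phi y]. *)
Lemma character_sum0 (phi : A -> complexR) y :
  {morph phi : u v / u + v >-> u * v} -> phi y != 1 -> \sum_x phi x = 0.
Proof.
move=> phiD /negPf phi_y; apply/eqP.
have : \sum_x phi x = phi y * \sum_x phi x.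
  rewrite [LHS](reindex_inj (addrI y)) mulr_sumr.
  by apply: eq_bigr => x _; rewrite phiD.
move/eqP; rewrite -subr_eq0 -[X in X - _]mul1r -mulrBl mulf_eq0 subr_eq0.
by rewrite eq_sym phi_y.
Qed.

Definition char_orbit (a : (A^c)^o) : character A := (a : A^c) *: eps.

Lemma char_orbit_is_linear : linear char_orbit.
Proof. by move=> a b c; rewrite /char_orbit scalerDl -scalerA. Qed.

HB.instance Definition _ :=
  GRing.isLinear.Build A^c (A^c)^o (character A) _ char_orbit
    char_orbit_is_linear.

Lemma char_orbitE (a : A) x : char_orbit a x = eps (a * x).
Proof. by rewrite ffunE. Qed.

Hypothesis ndl : forall a : A, (forall x, eps (a * x) = 1) -> a = 0.
Hypothesis ndr : forall x : A, (forall a, eps (a * x) = 1) -> x = 0.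

Lemma char_orbit_inj : injective char_orbit.
Proof.
apply: raddf_inj => a /(congr1 (fun chi : character A => char_val chi)) a0.
by apply: ndl => x; rewrite -char_orbitE a0 ffunE.
Qed.

(* The double sum over a and x of chi x * eps (- (a * x)) is #|A|, by
   orthogonality in a; it would vanish, by orthogonality in x, were chi
   different from every eps . a. *)
Lemma char_orbit_surj (chi : character A) : exists a, char_orbit a = chi.
Proof.
pose F a x := chi x * eps (- (a * x)).
have sumF : \sum_a \sum_x F a x = #|A|%:R.
  have F0 : \sum_a F a 0 = #|A|%:R.
    rewrite (eq_bigr (fun=> 1)) ?sumr_const // => a _.
    by rewrite /F mulr0 oppr0 !character0 mulr1.
  rewrite exchange_big (bigD1 0) // F0 -[RHS]addr0; congr (_ + _).
  apply: big1 => x /andP[_ x_neq0]; rewrite /F -mulr_sumr.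
  have /existsP[a eps_ax] : [exists a, eps (a * x) != 1].
    apply: contraNT x_neq0 => /existsPn E; apply/eqP/ndr => a.
    by apply/eqP; rewrite -[_ == _]negbK.
  rewrite (@character_sum0 _ (- a)) ?mulr0 ?mulNr ?opprK // => u v.
  by rewrite mulrDl opprD charD.
have /existsP[a sum_neq0] : [exists a, \sum_x F a x != 0].
  apply: contraT => /existsPn E; move: sumF; rewrite big1 => [/esym/eqP|a _].
    by rewrite pnatr_eq0 => /eqP/card0_eq/(_ 0).
  by apply/eqP; rewrite -[_ == _]negbK.
exists a; apply: char_eqP => x; rewrite char_orbitE.
have Fx : F a x = 1.
  apply/eqP; apply: contraNT sum_neq0 => Fx; apply/eqP.
  apply: character_sum0 Fx => u v.
  by rewrite /F mulrDr opprD !charD mulrACA.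
by rewrite -[LHS]mul1r -Fx -mulrA -charD addNr character0 mulr1.
Qed.

Lemma frobenius_of_generating_character : frobenius_ring A.
Proof.
exists char_orbit.
(* Surjectivity in boolean form, so that [xchoose] yields an inverse map. *)
have surj chi : exists a, char_orbit a == chi.
  by have [a /eqP] := char_orbit_surj chi; exists a.
exists (fun chi => xchoose (surj chi)) => [a|chi].
  by apply: char_orbit_inj; apply/eqP/(xchooseP (surj _)).
exact/eqP/(xchooseP (surj chi)).
Qed.

End GeneratingCharacter.

(** Take a root of [1 + X + ... + X^(p-1)], which divides [X^p - 1] and whose value at [1] is [p],
    nonzero in characteristic 0. *)
Lemma exists_root_of_unity_neq1 p :
  prime p -> exists2 z : complexR, z ^+ p = 1 & z != 1.
Proof.
move=> p_pr; pose q : {poly complexR} := \poly_(i < p) 1.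
have size_q : size q = p by rewrite /q size_poly_eq ?oner_neq0.
have [z] : exists z, root q z.
  by apply/closed_rootP; rewrite size_q neq_ltn prime_gt1 ?orbT.
rewrite /root horner_poly => /eqP qz.
have qz' : \sum_(i < p) z ^+ i = 0.
  by rewrite -[RHS]qz; apply: eq_bigr => i _; rewrite mul1r.
exists z; first by apply/eqP; rewrite -subr_eq0 subrX1 qz' mulr0.
apply: contraTneq p_pr => z1; move/eqP: qz'.
rewrite (eq_bigr (fun=> 1)) => [|i _]; last by rewrite z1 expr1n.
by rewrite sumr_const card_ord pnatr_eq0 => /eqP->.
Qed.

(** View [K] as an ['F_p]-space and raise a nontrivial [p]-th root of unity to the first coordinate
    in some basis. *)
Lemma exists_nontrivial_character (K : finFieldType) :
  exists psi : character K, exists x, psi x != 1.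
Proof.
have [p p_pr pcharKp] := finPcharP K.
pose V := pPrimeCharType pcharKp.
have [z zp z_neq1] := exists_root_of_unity_neq1 p_pr.
have z_neq0 : z != 0.
  apply: contraTneq (oner_neq0 complexR) => z0.
  by rewrite -zp z0 expr0n gtn_eqF ?prime_gt0 ?eqxx.
pose v := vbasis {: V}.
have dimV : (0 < \dim {: V})%N.
  rewrite lt0n dimv_eq0; apply/negP => /eqP V0.
  by have := memvf (1 : V); rewrite V0 memv0 oner_eq0.
pose l (x : V) : 'F_p := coord v (Ordinal dimV) x.
have natFpD (a b : 'F_p) : (a + b)%R = ((a + b) %% p)%N :> nat.
  by congr (_ %% _)%N; exact: Fp_cast.
have psiP : is_character [ffun x : K => z ^+ l x].
  apply/is_characterP; split=> [x|x y]; rewrite !ffunE ?expf_neq0 //.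
  (* Since [z ^+ p = 1], exponents matter only modulo [p], as does addition in ['F_p]. *)
  rewrite -exprD -(expr_mod _ zp) -[RHS](expr_mod _ zp); congr (_ ^+ _).
  by rewrite /l raddfD natFpD modn_mod.
(* The first basis vector has first coordinate 1, so its value is [z]. *)
exists (Character psiP); exists (v`_(Ordinal dimV) : V).
by rewrite ffunE /l coord_free ?(basis_free (vbasisP _)) ?eqxx.
Qed.

Section Coefficients.
Variables (G : finGroupType) (K : finFieldType).
Variables (Theta : G -> {rmorphism K -> K}) (alpha : G -> G -> {unit K}).
Hypotheses (homTheta : hom_to_Aut Theta) (cocyc : normalized_cocycle alpha).
Hypothesis stab : stabilized_by Theta alpha.

Local Notation bar := (tsg_bar homTheta cocyc stab).

Lemma scaled_tsg_barE (c : K) g h : (c *: bar g) h = c * (h == g)%:R.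
Proof. by rewrite !ffunE. Qed.

(** Among the terms of [a], only that of [bar g] reaches [bar 1], since [h * g^-1 = 1] forces
    [h = g]. *)
Lemma tsg_mul_barr_coef1 a (c : K) g :
  tsg_mul a (c *: bar g^-1%g) 1%g = a g * Theta g c * val (alpha g g^-1%g).
Proof.
rewrite {1}[a]tsg_sumE tsg_mul_suml sum_ffunE (bigD1 g) //=.
rewrite big1 => [|h h_neq_g].
  by rewrite addr0 tsg_mul_bar scaled_tsg_barE mulgV eqxx mulr1.
by rewrite tsg_mul_bar scaled_tsg_barE eq_sym -eq_mulgV1 (negPf h_neq_g) mulr0.
Qed.

Lemma tsg_mul_barl_coef1 a (c : K) g :
  tsg_mul (c *: bar g^-1%g) a 1%g =
  c * Theta g^-1%g (a g) * val (alpha g^-1%g g).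
Proof.
rewrite {1}[a]tsg_sumE tsg_mul_sumr sum_ffunE (bigD1 g) //=.
rewrite big1 => [|h h_neq_g].
  by rewrite addr0 tsg_mul_bar scaled_tsg_barE mulVg eqxx mulr1.
rewrite tsg_mul_bar scaled_tsg_barE eq_sym -eq_invg_mul invgK eq_sym.
by rewrite (negPf h_neq_g) mulr0.
Qed.

End Coefficients.

Theorem theorem1p6 (G : finGroupType) (K : finFieldType)
    (Theta : G -> {rmorphism K -> K}) (homTheta : hom_to_Aut Theta)
    (alpha : G -> G -> {unit K}) (cocyc : normalized_cocycle alpha)
    (stab : stabilized_by Theta alpha) :
  frobenius_ring (twisted_skew_group_ring homTheta cocyc stab).
Proof.
set R := twisted_skew_group_ring _ _ _.
have [psi [y psi_y]] := exists_nontrivial_character K.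
have epsP : is_character [ffun r : R => psi (r 1%g)].
  by apply/is_characterP; split=> *; rewrite !ffunE ?char_neq0 ?charD.
have unit_neq0 g h : val (alpha g h) != 0 by rewrite -unitfE (valP (alpha g h)).
apply: (@frobenius_of_generating_character R (Character epsP)) => a eps1;
  apply/ffunP => g; rewrite [RHS]ffunE; apply/eqP;
  apply: contraNT psi_y => ag_neq0.
- have [Theta_inv _ ThetaK] := homTheta.1 g.
  (* Solves [a g * Theta g c * alpha g g^-1 = y], so that [eps1] would give [psi y = 1]. *)
  pose c := Theta_inv ((a g)^-1 * y / val (alpha g g^-1%g)).
  rewrite -[X in _ == X](eps1 (c *: tsg_bar homTheta cocyc stab g^-1%g)) ffunE.
  by rewrite tsg_mul_barr_coef1 ThetaK mulrA mulVKf // divfK.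
- set b := Theta g^-1%g (a g).
  have b_neq0 : b != 0 by rewrite fmorph_eq0.
  (* Solves [c * b * alpha g^-1 g = y], for the product on the other side. *)
  pose c := y / val (alpha g^-1%g g) / b.
  rewrite -[X in _ == X](eps1 (c *: tsg_bar homTheta cocyc stab g^-1%g)) ffunE.
  by rewrite tsg_mul_barl_coef1 -/b !divfK.
Qed.
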